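(* Let $\theta=(k_r)$ be a lacunary sequence with $\liminf_r q_r>1$. Let $A\subset\mathbb{R}$, let $f:A\to\mathbb{R}$ be $N_\theta$-ward continuous on $A$, and let $E\subset A$ be $N_\theta$-ward compact. Then $f(E)$ is $N_\theta$-ward compact.
   Context: A lacunary sequence is an increasing sequence of integers $\theta=(k_r)_{r\ge 0}$ with $k_0=0$ and $h_r:=k_r-k_{r-1}\to\infty$. Put $I_r=(k_{r-1},k_r]$ (integers in this interval) and $q_r=k_r/k_{r-1}$ (for $r\ge 2$). A real sequence $(\alpha_k)_{k\ge1}$ is $N_\theta$-quasi-Cauchy if $\lim_{r\to\infty}\frac1{h_r}\sum_{k\in I_r}|\alpha_{k+1}-\alpha_k|=0$. A set $E\subset\mathbb{R}$ is $N_\theta$-ward compact if every sequence of points in $E$ has an $N_\theta$-quasi-Cauchy subsequence (re-indexed by $1,2,3,\dots$). A function $f:A\to\mathbb{R}$ is $N_\theta$-ward continuous on $A$ if $(f(\alpha_k))$ is $N_\theta$-quasi-Cauchy whenever $(\alpha_k)$ is an $N_\theta$-quasi-Cauchy sequence of points in $A$. *)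

(* Defs.v *)
From HB Require Import structures.
From mathcomp Require Import all_boot all_order all_algebra.
From mathcomp Require Import all_classical all_reals all_analysis.

Set Implicit Arguments.
Unset Strict Implicit.
Unset Printing Implicit Defensive.

Import Order.TTheory GRing.Theory Num.Theory.
Import numFieldNormedType.Exports.

Local Open Scope classical_set_scope.
Local Open Scope ring_scope.

(* Real sequences are indexed by k >= 1: for alpha : nat -> R the value alpha 0
   plays no role in any of the definitions below.  Likewise the blocks I_r exist
   only for r >= 1 and the ratios q_r for r >= 2; the values of block_length and
   block_ratio at smaller r are junk and matter neither for limits nor for the
   limit inferior. *)

Definition block_length (theta : nat -> nat) (r : nat) : nat :=
  (theta r - theta r.-1)%N.

(* An increasing integer sequence starting at 0 takes its values in nat. *)
Definition lacunary (theta : nat -> nat) : Prop :=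
  [/\ theta 0%N = 0%N,
      {homo theta : i j / (i < j)%N} &
      block_length theta r @[r --> \oo] --> \oo].

Definition block_ratio (R : realType) (theta : nat -> nat) (r : nat) : R :=
  (theta r)%:R / (theta r.-1)%:R.

Definition quasi_cauchy (R : realType) (theta : nat -> nat) (alpha : nat -> R) :
    Prop :=
  (block_length theta r)%:R^-1 *
    (\sum_((theta r.-1).+1 <= k < (theta r).+1) `|alpha k.+1 - alpha k|)
    @[r --> \oo] --> (0 : R).

Definition points_in (R : realType) (A : set R) (alpha : nat -> R) : Prop :=
  forall k, (1 <= k)%N -> A (alpha k).

(* A strictly increasing phi : nat -> nat maps indices k >= 1 to indices >= 1,
   and every strictly increasing choice of indices phi 1 < phi 2 < ... with
   1 <= phi 1 extends to such a phi by phi 0 = 0. *)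
Definition ward_compact (R : realType) (theta : nat -> nat) (E : set R) : Prop :=
  forall alpha : nat -> R, points_in E alpha ->
    exists2 phi : nat -> nat,
      {homo phi : i j / (i < j)%N} & quasi_cauchy theta (alpha \o phi).

(* A function A -> R is represented by a total function; its values outside A
   are irrelevant. *)
Definition ward_continuous (R : realType) (theta : nat -> nat) (A : set R)
    (f : R -> R) : Prop :=
  forall alpha : nat -> R, points_in A alpha ->
    quasi_cauchy theta alpha -> quasi_cauchy theta (f \o alpha).

(* Main.v *)
Require Import Defs.
From HB Require Import structures.
From mathcomp Require Import all_boot all_order all_algebra.
From mathcomp Require Import all_classical all_reals all_analysis.

Set Implicit Arguments.
Unset Strict Implicit.
Unset Printing Implicit Defensive.

Import Order.TTheory GRing.Theory Num.Theory.
Import numFieldNormedType.Exports.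

Local Open Scope classical_set_scope.
Local Open Scope ring_scope.

(** Compactness of [E] gives a quasi-Cauchy subsequence [beta \o phi]; as it lies in [A], [f] keeps
    it quasi-Cauchy, and its image is the subsequence of [alpha] along the same [phi]. *)

(** Every block starts at an index at least 1, so the value at 0 never enters the sums. *)
Lemma eq_quasi_cauchy (R : realType) (theta : nat -> nat) (a b : nat -> R) :
  (forall k, (1 <= k)%N -> a k = b k) ->
  quasi_cauchy theta a -> quasi_cauchy theta b.
Proof.
move=> eq_ab; rewrite /quasi_cauchy.
under eq_fun => r.
  under eq_big_nat => k /andP[lt_k _]
    do rewrite !eq_ab ?(leq_trans _ lt_k) //.
  over.
by [].
Qed.

Theorem theorem17 (R : realType) (theta : nat -> nat)
    (theta_lacunary : lacunary theta)
    (liminf_gt1 : (1 < limn_einf (fun r => (block_ratio R theta r)%:E))%E)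
    (A : set R) (f : R -> R) (f_cont : ward_continuous theta A f)
    (E : set R) (sub_EA : E `<=` A) (E_compact : ward_compact theta E) :
  ward_compact theta (f @` E).
Proof.
move=> alpha alphaP.
have [beta betaP] : {beta : nat -> R &
    forall k, (1 <= k)%N -> E (beta k) /\ f (beta k) = alpha k}.
  apply: (@choice _ _ (fun k b => (1 <= k)%N -> E b /\ f b = alpha k)) => k.
  case: (ltnP 0 k) => [/alphaP[b Eb fb]|_]; first by exists b.
  by exists 0.
have [phi phi_incr beta_phi] := E_compact beta (fun k k1 => (betaP k k1).1).
(* [phi k > phi 0 >= 0], so the subsequence avoids the junk [beta 0]. *)
have phi_ge1 k : (1 <= k)%N -> (1 <= phi k)%N.
  by move=> /phi_incr; apply: leq_ltn_trans.
(* [f \o beta \o phi] and [alpha \o phi] may differ at index 0, as [phi 0] can be 0. *)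
exists phi => //; apply: (eq_quasi_cauchy (a := f \o (beta \o phi))).
  by move=> k /phi_ge1 /betaP[].
by apply: f_cont => // k /phi_ge1 /betaP[/sub_EA].
Qed.
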